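(* Let $s:\mathbb{Z}_{\ge 0}\to\mathbb{Z}_{\ge 0}$ be the sloping binary number function, $s(n)=\sum_{k\ge 0}\operatorname{bit}_k(n+k)\,2^k$. Then: (i) For every $n>0$ and every integer $m>\log_2 n$, $$ s(n) = 2^m - \tfrac12 - \tfrac12\sum_{k=0}^{m}(-1)^{\lfloor (n+k)/2^k\rfloor}\,2^k. $$ (ii) $s(0)=0$ and, for all integers $i\ge 0$ and $0\le j\le 2^i-1$, $$ s(2^i+j)=\begin{cases} 2^i+s(j) & \text{if } j\neq 2^i-i-1,\\ 3\cdot 2^i+s(j) & \text{if } j=2^i-i-1.\end{cases} $$ (iii) For all $n\ge 0$, $$ s(n)= n+\sum_{k\ge 1,\; n+k\equiv 0 \pmod{2^k}} 2^k. $$ (iv) The values $s(n)$, $n\ge 0$, are pairwise distinct, and $s(n)\ge n$ for all $n\ge 0$.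
   Context: For integers $m\ge 0$ and $k\ge 0$, let $\operatorname{bit}_k(m)=\lfloor m/2^k\rfloor \bmod 2$ denote the coefficient of $2^k$ in the binary expansion of $m$. For $n\ge 0$ define $s(n)=\sum_{k\ge 0}\operatorname{bit}_k(n+k)\,2^k$ (a finite sum, since $\operatorname{bit}_k(n+k)=0$ once $n+k<2^k$). Equivalently, $s(n)$ is obtained by writing the binary expansions of $0,1,2,\dots$ right-justified one per row and reading along the diagonal that starts at the units digit of row $n$ and slopes upward to the right-to-left, i.e. the $2^k$ digit of $s(n)$ is the $2^k$ digit of $n+k$. The first values are $0,3,6,5,4,15,10,9,8,11,\dots$. *)

(* Defs.v *)
From mathcomp Require Import all_boot all_algebra.
From mathcomp Require Import boolp classical_sets cardinality fsbigop.
Set Implicit Arguments.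
Unset Strict Implicit.
Unset Printing Implicit Defensive.

Local Open Scope classical_set_scope.

Definition bit (k m : nat) : nat := (m %/ 2 ^ k) %% 2.

(* Sum over all k : nat of the finitely many nonzero terms (a big operator
   indexed by [k \in A] is set to 0 when infinitely many terms are nonzero;
   [finite_bit_support] excludes this). *)
Definition sloping (n : nat) : nat :=
  \big[addn/0]_(k \in [set: nat]) (bit k (n + k) * 2 ^ k).

Lemma ltn_add_exp2 (n k : nat) : n < k -> n + k < 2 ^ k.
Proof.
case: k => // k; rewrite ltnS => nk.
rewrite expnS mul2n -addnn -addSn.
by apply: leq_add; [apply: leq_ltn_trans nk _|]; apply: ltn_expl.
Qed.

Lemma finite_bit_support (n : nat) :
  finite_set [set k | bit k (n + k) * 2 ^ k <> 0].
Proof.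
apply: (sub_finite_set _ (finite_II n.+1)) => k /= nz.
rewrite ltnS leqNgt; apply/negP => nk; apply: nz.
by rewrite /bit divn_small ?ltn_add_exp2.
Qed.

Lemma finite_dvd_exp2 (n : nat) :
  finite_set [set k | 1 <= k /\ n + k = 0 %[mod 2 ^ k]].
Proof.
apply: (sub_finite_set _ (finite_II n.+1)) => k /= [k0 nk0].
rewrite ltnS leqNgt; apply/negP => nk.
move: nk0; rewrite mod0n modn_small ?ltn_add_exp2 // => /eqP.
by rewrite addn_eq0 (gtn_eqF k0) andbF.
Qed.

(* Main.v *)
(* Since bit_k(m) 2^k = (m mod 2^(k+1)) - (m mod 2^k), the sum defining s(n)
   nearly telescopes along the residues (n + k) mod 2^k: passing from
   n + k to n + k + 1 adds 1 to the residue mod 2^(k+1), except when 2^(k+1)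
   divides n + k + 1, where it wraps around and loses 2^(k+1).  This gives
   (iii).  Formula (iii) then yields (ii), because adding 2^i to j changes only
   the divisibility condition for k = i + 1, and (iv), because modulo 2^(k+1)
   it expresses s(n) as n plus a function of n mod 2^k, so that s(n) determines
   n modulo every power of 2. *)
Require Import Defs.
From mathcomp Require Import all_boot all_order all_algebra.
From mathcomp Require Import classical_sets fsbigop reals exp.
From mathcomp Require Import functions zify ring.
Import Order.TTheory GRing.Theory Num.Theory.

Local Open Scope classical_set_scope.
Local Open Scope nat_scope.

(** The sum in (iii) cut off at exponent [N]; the shift to [k.+1] builds in that exponents start at
    1. *)
Definition carries (N n : nat) : nat :=
  \sum_(k < N) (2 ^ k.+1 %| n + k.+1) * 2 ^ k.+1.

Lemma bit_exp2 (k m : nat) : bit k m * 2 ^ k + m %% 2 ^ k = m %% 2 ^ k.+1.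
Proof.
rewrite /bit modn_divl -expnS -(modn_dvdm m (dvdn_exp2l 2 (leqnSn k))).
by rewrite -divn_eq.
Qed.

Lemma modnS_wrap (m d : nat) : 0 < d ->
  m.+1 %% d + (d %| m.+1) * d = (m %% d).+1.
Proof.
move=> d0; apply/(@addnI (m %/ d * d)).
rewrite addnS -divn_eq [RHS](divn_eq m.+1 d) divnS // mulnDl.
by rewrite addnCA addnC [X in X + _]addnC.
Qed.

(** The residue is the boundary term of the telescoping. Once [n + N < 2 ^ N] it equals [n + N], and
    cancelling [N] leaves (iii). *)
Lemma sum_bit_carries (N n : nat) :
  \sum_(k < N) bit k (n + k) * 2 ^ k + N = (n + N) %% 2 ^ N + carries N n.
Proof.
rewrite /carries; elim: N => [|N IHN].
  by rewrite !big_ord0 expn0 modn1.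
rewrite !big_ord_recr /= !addnS addnCA modnS_wrap ?expn_gt0 //.
by rewrite addnAC IHN -bit_exp2 addnS addnC addnA [in RHS]addnC.
Qed.

(** Makes [n + N < 2 ^ N] a cutoff criterion: beyond such an [N], the digits and the divisibility
    terms all vanish. *)
Lemma ltn_add_exp2W {n N k : nat} : n + N < 2 ^ N -> N <= k -> n + k < 2 ^ k.
Proof.
move=> nN /subnK <-; elim: (k - N) => // d IHd.
rewrite addSn expnS mul2n -addnn addnS -addn1.
by rewrite -addSn leq_add // expn_gt0.
Qed.

Lemma slopingE {N n : nat} : n + N < 2 ^ N ->
  sloping n = \sum_(k < N) bit k (n + k) * 2 ^ k.
Proof.
move=> nN; rewrite /sloping -(big_mkord xpredT (fun k => bit k (n + k) * 2 ^ k)).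
rewrite (fsbigE (index_iota 0 N)) ?iota_uniq //.
  by apply: eq_bigl => k; rewrite in_setT.
move=> k _; rewrite mem_index_iota /= -leqNgt => Nk.
by rewrite /bit divn_small ?mul0n //; apply: ltn_add_exp2W Nk.
Qed.

Lemma sloping_carries {N n : nat} : n + N < 2 ^ N -> sloping n = n + carries N n.
Proof.
move=> nN; have := sum_bit_carries N n.
by rewrite -slopingE // modn_small //; lia.
Qed.

Lemma fsum_carries {N n : nat} : n + N < 2 ^ N ->
  \big[addn/0]_(k \in [set k : nat | 1 <= k /\ n + k = 0 %[mod 2 ^ k]]) 2 ^ k
    = carries N n.
Proof.
move=> nN; rewrite fsbig_mkcond (fsbigE (index_iota 1 N.+1)) ?iota_uniq //.
  under eq_bigl do rewrite in_setT.
  rewrite big_add1 big_mkord; apply: eq_bigr => k _; rewrite /patch /dvdn.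
  by case: eqP => [dv|ndv]; rewrite ?mul1n ?mul0n;
    [rewrite mem_set|rewrite memNset] => //=; rewrite mod0n // => -[].
move=> k _; rewrite mem_index_iota negb_and -!leqNgt => kN.
rewrite /patch memNset //= => -[k1 dv].
have Nk : N <= k by lia.
have := ltn_add_exp2W nN Nk; move: dv; rewrite mod0n => dv nk.
by move: dv; rewrite modn_small //; lia.
Qed.

Lemma carries_modn {k n n' : nat} :
  n = n' %[mod 2 ^ k] -> carries k n = carries k n'.
Proof.
move=> nn'; apply: eq_bigr => i _; congr ((_ : bool) * _).
have e : n = n' %[mod 2 ^ i.+1].
  by rewrite -(modn_dvdm n (dvdn_exp2l 2 (ltn_ord i))) nn' modn_dvdm ?dvdn_exp2l.
by rewrite /dvdn -modnDml e modnDml.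
Qed.

(** The terms dropped are all multiples of [2 ^ k.+1]. *)
Lemma carries_mod_exp2 {N k : nat} (n : nat) : k <= N ->
  carries N n = carries k n %[mod 2 ^ k.+1].
Proof.
move=> /subnK <-; elim: (N - k) => // d IHd.
rewrite addSn /carries big_ord_recr /= -/(carries _ _) -modnDmr.
have /eqP -> : (2 ^ k.+1 %| (2 ^ (d + k).+1 %| n + (d + k).+1) * 2 ^ (d + k).+1).
  by rewrite dvdn_mull // dvdn_exp2l // ltnS leq_addl.
by rewrite addn0.
Qed.

Lemma sloping_mod_exp2 (k n : nat) : sloping n = n + carries k n %[mod 2 ^ k.+1].
Proof.
(* This bound exceeds [n], hence is a valid cutoff, and is at least [k], hence can be lowered to
   [k]. *)
have nN : n + (n.+1 + k) < 2 ^ (n.+1 + k) by apply: ltn_add_exp2; lia.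
by rewrite (sloping_carries nN) -modnDmr (carries_mod_exp2 _ (leq_addl _ _)) modnDmr.
Qed.

Lemma sloping_inj : injective sloping.
Proof.
move=> n n' ss.
have nn' k : n = n' %[mod 2 ^ k].
  elim: k => [|k IHk]; first by rewrite !modn1.
  (* Agreement modulo [2 ^ k] makes the two carry sums equal; cancelling them modulo [2 ^ k.+1]
     gains one binary digit. *)
  have /eqP := sloping_mod_exp2 k n.
  by rewrite ss sloping_mod_exp2 (carries_modn IHk) eqn_modDr => /eqP.
have := nn' (n + n').+1.
rewrite !modn_small // expnS; have := ltn_expl (n + n') (ltnSn 1); lia.
Qed.

Lemma sloping_exp2D (i j : nat) : j < 2 ^ i ->
  sloping (2 ^ i + j) =
    2 ^ i + sloping j + (j == 2 ^ i - i - 1) * 2 ^ i.+1.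
Proof.
move=> ji.
have i_lt := ltn_expl i (ltnSn 1); have e1 := expnS 2 i; have e2 := expnS 2 i.+1.
rewrite (@sloping_carries i.+1 j); last by lia.
rewrite (@sloping_carries i.+2 (2 ^ i + j)); last by lia.
rewrite /carries !big_ord_recr /=.
have -> : \sum_(k < i) (2 ^ k.+1 %| 2 ^ i + j + k.+1) * 2 ^ k.+1 =
          \sum_(k < i) (2 ^ k.+1 %| j + k.+1) * 2 ^ k.+1.
  by apply: eq_bigr => k _; rewrite -addnA dvdn_addr // dvdn_exp2l.
have -> : (2 ^ i.+1 %| j + i.+1) = false by rewrite gtnNdvd //; lia.
have -> : (2 ^ i.+2 %| 2 ^ i + j + i.+2) = false by rewrite gtnNdvd //; lia.
(* The sum lies strictly between 0 and [2 * 2 ^ i.+1], so the quotient can only be 1; [i < 2 ^ i]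
   keeps the subtraction from truncating. *)
have -> : (2 ^ i.+1 %| 2 ^ i + j + i.+1) = (j == 2 ^ i - i - 1).
  apply/idP/eqP => [/dvdnP[[|[|q]]]|->]; [lia|lia|nia|].
  by rewrite (_ : _ + _ = 2 ^ i.+1) //; lia.
by rewrite !mul0n !addn0 !addnA.
Qed.

Lemma lt_exp2_ln {R : realType} {n m : nat} : 0 < n ->
  (ln (n%:R : R) / ln 2 < m%:R)%R -> n < 2 ^ m.
Proof.
move=> n0; rewrite ltr_pdivrMr ?ln_gt0 ?ltr1n // mulr_natl -lnXn ?ltr0n //.
by rewrite ltr_ln ?posrE ?exprn_gt0 ?ltr0n // -natrX ltr_nat.
Qed.

Lemma signr_bit (R : pzRingType) (k m : nat) :
  ((-1) ^+ (m %/ 2 ^ k)%N = 1 - 2 * (bit k m)%:R :> R)%R.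
Proof.
rewrite -signr_odd /bit modn2; case: odd; rewrite ?mulr1 ?mulr0 ?subr0 //.
by rewrite expr1 opprD addrA subrr add0r.
Qed.

(** Each sign is 1 minus twice a bit; the ones contribute half the geometric sum [2 ^ m.+1 - 1]. *)
Lemma sum_signr_bit (F : numFieldType) (n m : nat) :
  (2^-1 * \sum_(0 <= k < m.+1) (-1) ^+ ((n + k) %/ 2 ^ k)%N * 2 ^+ k =
   2 ^+ m - 2^-1 - (\sum_(k < m.+1) bit k (n + k) * 2 ^ k)%N%:R :> F)%R.
Proof.
rewrite big_mkord.
elim: m => [|m IHm].
  by rewrite !big_ord1 signr_bit !expr0 muln1; field.
rewrite big_ord_recr /= mulrDr IHm [in RHS]big_ord_recr /= signr_bit.
by rewrite natrD natrM natrX exprS; field.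
Qed.

Theorem theorem1 (R : realType) :
  (forall n m : nat, 0 < n ->
     (ln (n%:R : R) / ln 2 < m%:R)%R ->
     ((sloping n)%:R = 2 ^+ m - 2^-1
        - 2^-1 * \sum_(0 <= k < m.+1)
                   (-1) ^+ ((n + k) %/ 2 ^ k)%N * 2 ^+ k :> R)%R)
  /\ (sloping 0 = 0
      /\ forall i j : nat, j <= 2 ^ i - 1 ->
           sloping (2 ^ i + j) =
             if j != 2 ^ i - i - 1 then 2 ^ i + sloping j
             else 3 * 2 ^ i + sloping j)
  /\ (forall n : nat,
        sloping n = n + \big[addn/0]_(k \in [set k : nat |
                          1 <= k /\ n + k = 0 %[mod 2 ^ k]]) 2 ^ k)
  /\ (injective sloping /\ forall n : nat, n <= sloping n).
Proof.
split; [|split; [split|split; [|split]]].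
- move=> n m n0 /(lt_exp2_ln n0) nm.
  have m_lt := ltn_expl m (ltnSn 1).
  (* Both [n] and [m] are below [2 ^ m], so [m.+1] is a valid cutoff. *)
  rewrite sum_signr_bit -(@slopingE m.+1); last by rewrite expnS; lia.
  by ring.
- by rewrite (@slopingE 1) // big_ord1.
- move=> i j ji; rewrite sloping_exp2D; last by have := expn_gt0 2 i; lia.
  by case: eqP => _ /=; rewrite ?mul0n ?mul1n ?expnS; lia.
- move=> n; have nN := ltn_add_exp2 (ltnSn n).
  by rewrite (fsum_carries nN) (sloping_carries nN).
- exact: sloping_inj.
- by move=> n; rewrite (sloping_carries (ltn_add_exp2 (ltnSn n))) leq_addr.
Qed.
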